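(* Let $\mathcal K_0$ be a Fraïssé class in a signature $L_0$, let $L=L_0\cup\{<\}$, and let $\mathcal K,\mathcal K'$ be reasonable Fraïssé order classes in $L$ that are expansions of $\mathcal K_0$ (i.e., $\mathcal K|L_0=\mathcal K'|L_0=\mathcal K_0$). If $\mathcal K$ and $\mathcal K'$ both satisfy the Ramsey property and the ordering property, then $\mathcal K$ and $\mathcal K'$ are simply bi-definable.
   Context: Fraïssé classes: classes of finite structures closed under isomorphism, with countably many isomorphism types, arbitrarily large finite members, and the hereditary, joint embedding and amalgamation properties; a Fraïssé order class in $L\ni<$ is one in which $<$ is always a linear order. $\boldsymbol A|L_0$ is the reduct forgetting $<$; $\langle\boldsymbol A_0,\prec\rangle$ is the expansion of an $L_0$-structure interpreting $<$ as $\prec$. $\mathcal K$ is reasonable if for every embedding $\pi:\boldsymbol A_0\to\boldsymbol B_0$ in $\mathcal K_0$ and linear order $\prec$ on $A_0$ with $\langle\boldsymbol A_0,\prec\rangle\in\mathcal K$ there is a linear order $\prec'$ on $B_0$ with $\langle\boldsymbol B_0,\prec'\rangle\in\mathcal K$ and $\pi$ an embedding of the expansions. Ramsey property: $\mathcal K$ hereditary and for all $\boldsymbol A\le\boldsymbol B$ in $\mathcal K$, $k\ge2$, there is $\boldsymbol C\in\mathcal K$, $\boldsymbol B\le\boldsymbol C$, such that any $k$-coloring of the substructures of $\boldsymbol C$ isomorphic to $\boldsymbol A$ is constant on those lying inside some substructure of $\boldsymbol C$ isomorphic to $\boldsymbol B$. Ordering property: for every $\boldsymbol A_0\in\mathcal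 K_0$ there is $\boldsymbol B_0\in\mathcal K_0$ such that $\langle\boldsymbol A_0,\prec\rangle$ embeds in $\langle\boldsymbol B_0,\prec'\rangle$ whenever both are in $\mathcal K$. A simple formula in $L$ is a quantifier-free formula of the infinitary logic $L_{\omega_1\omega}$, i.e., built from atomic $L$-formulas by negations and countable conjunctions and disjunctions. $\mathcal K,\mathcal K'$ (expansions of $\mathcal K_0$) are simply bi-definable if there are simple formulas $\varphi(x,y),\varphi'(x,y)$ in $L$ such that for every $\boldsymbol A_0\in\mathcal K_0$, the map $\Phi$ sending $\boldsymbol A=\langle\boldsymbol A_0,\prec\rangle\in\mathcal K$ to $\langle\boldsymbol A_0,\prec'\rangle$, where $a\prec'b\Leftrightarrow\boldsymbol A\models\varphi[a,b]$, is a bijection from the expansions of $\boldsymbol A_0$ lying in $\mathcal K$ onto those lying in $\mathcal K'$, with inverse the map $\Phi'$ defined analogously from $\varphi'$. *)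

(* Defs.v *)
From HB Require Import structures.
From mathcomp Require Import all_boot.
From mathcomp Require Import boolp classical_sets functions.

Set Implicit Arguments.
Unset Strict Implicit.
Unset Printing Implicit Defensive.

Record signature := Signature {
  rsym : Type;
  rar : rsym -> nat;
  fsym : Type;
  far : fsym -> nat }.

(* Only finite structures are needed. Universes are nonempty, and constants
   are function symbols of arity 0. *)
Record fstructure (L : signature) := FStructure {
  carrier :> finType;
  carrier_gt0 : 0 < #|carrier|;
  rint : forall R : rsym L, pred {ffun 'I_(rar R) -> carrier};
  fint : forall f : fsym L, {ffun 'I_(far f) -> carrier} -> carrier }.

Arguments rint {L} A R _ : rename.
Arguments fint {L} A f _ : rename.

Definition fmap {n : nat} {T U : Type} (h : T -> U) (t : {ffun 'I_n -> T}) :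
  {ffun 'I_n -> U} := [ffun i => h (t i)].

Definition embedding (L : signature) (A B : fstructure L) (h : A -> B) : Prop :=
  [/\ injective h,
      forall (R : rsym L) t, rint B R (fmap h t) = rint A R t
    & forall (f : fsym L) t, fint B f (fmap h t) = h (fint A f t)].

Definition embeds (L : signature) (A B : fstructure L) : Prop :=
  exists h : A -> B, embedding h.

Definition isomorphic (L : signature) (A B : fstructure L) : Prop :=
  exists2 h : A -> B, embedding h & bijective h.

Section Substructures.
Variables (L : signature) (C : fstructure L).

Definition is_substructure (S : {set C}) : Prop :=
  0 < #|S| /\
  forall (f : fsym L) (t : {ffun 'I_(far f) -> C}),
    (forall i, t i \in S) -> fint C f t \in S.

Variables (S : {set C}) (HS : is_substructure S).

Let T : finType := {x : C | x \in S}.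

Lemma substructure_gt0 : 0 < #|T|.
Proof. by rewrite card_sig; case: HS. Qed.

Lemma substructure_closed (f : fsym L) (t : {ffun 'I_(far f) -> T}) :
  fint C f (fmap val t) \in S.
Proof. by case: HS => _; apply=> i; rewrite ffunE; exact: valP. Qed.

Definition substructure : fstructure L :=
  @FStructure L T substructure_gt0
    (fun R t => rint C R (fmap val t))
    (fun f t => exist _ (fint C f (fmap val t)) (substructure_closed t)).

End Substructures.

(* S is the universe of a substructure of C isomorphic to A. *)
Definition is_copy (L : signature) (A C : fstructure L) (S : {set C}) : Prop :=
  exists HS : is_substructure S, isomorphic (substructure HS) A.

Definition class (L : signature) := fstructure L -> Prop.

Definition iso_closed (L : signature) (K : class L) : Prop :=
  forall A B, isomorphic A B -> K A -> K B.

Definition countably_many_types (L : signature) (K : class L) : Prop :=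
  exists e : nat -> fstructure L, forall A, K A -> exists n, isomorphic A (e n).

Definition arbitrarily_large (L : signature) (K : class L) : Prop :=
  forall n, exists2 A, K A & n <= #|A|.

Definition hereditary (L : signature) (K : class L) : Prop :=
  forall A B, embeds A B -> K B -> K A.

Definition joint_embedding (L : signature) (K : class L) : Prop :=
  forall A B, K A -> K B -> exists C, [/\ K C, embeds A C & embeds B C].

Definition amalgamation (L : signature) (K : class L) : Prop :=
  forall (A B C : fstructure L) (f : A -> B) (g : A -> C),
    K A -> K B -> K C -> embedding f -> embedding g ->
    exists (D : fstructure L) (r : B -> D) (s : C -> D),
      [/\ K D, embedding r, embedding s & r \o f =1 s \o g].

Record fraisse_class (L : signature) (K : class L) : Prop := FraisseClass {
  fraisse_iso : iso_closed K;
  fraisse_countable : countably_many_types K;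
  fraisse_large : arbitrarily_large K;
  fraisse_hp : hereditary K;
  fraisse_jep : joint_embedding K;
  fraisse_ap : amalgamation K }.

(* The k-colorings of the copies of A are taken to be restrictions of colorings
   of all subsets of C; the values outside the copies of A are never used. *)
Definition ramsey_property (L : signature) (K : class L) : Prop :=
  hereditary K /\
  forall A B, K A -> K B -> embeds A B ->
  forall k, 2 <= k ->
  exists C : fstructure L, [/\ K C, embeds B C &
    forall c : {set C} -> 'I_k,
    exists B' : {set C}, is_copy B B' /\
    exists i : 'I_k, forall A' : {set C},
      is_copy A A' -> A' \subset B' -> c A' = i].

(* L0 + {<}: the new binary symbol < is None. *)
Definition add_lt (L0 : signature) : signature := {|
  rsym := option (rsym L0);
  rar := oapp (@rar L0) 2;
  fsym := fsym L0;
  far := @far L0 |}.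

Section Orders.
Variable L0 : signature.
Notation L := (add_lt L0).

Definition reduct (A : fstructure L) : fstructure L0 :=
  @FStructure L0 A (carrier_gt0 A)
    (fun R : rsym L0 => rint A (Some R))
    (fun f : fsym L0 => @fint L A f).

Definition expand_rint (A0 : fstructure L0) (r : rel A0) (R : rsym L) :
    pred {ffun 'I_(rar R) -> A0} :=
  match R return pred {ffun 'I_(@rar L R) -> A0} with
  | Some R0 => rint A0 R0
  | None => fun t : {ffun 'I_2 -> A0} => r (t ord0) (t ord_max)
  end.

Definition expand (A0 : fstructure L0) (r : rel A0) : fstructure L :=
  @FStructure L A0 (carrier_gt0 A0) (expand_rint r) (@fint L0 A0).

Definition lt_of (A : fstructure L) : rel A :=
  fun x y => rint A None [ffun i : 'I_2 => if i == ord0 then x else y].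

Definition linear_order (T : eqType) (r : rel T) : Prop :=
  [/\ irreflexive r, transitive r & forall x y, x != y -> r x y || r y x].

Definition fraisse_order_class (K : class L) : Prop :=
  fraisse_class K /\ forall A, K A -> linear_order (@lt_of A).

Definition class_reduct (K : class L) : class L0 :=
  fun A0 => exists2 A, K A & reduct A = A0.

Definition expansion_of (K : class L) (K0 : class L0) : Prop :=
  forall A0, class_reduct K A0 <-> K0 A0.

(* In the next two definitions K0 is the class of reducts of K. *)
Definition reasonable (K : class L) : Prop :=
  forall (A0 B0 : fstructure L0) (h : A0 -> B0) (r : rel A0),
    class_reduct K A0 -> class_reduct K B0 -> embedding h ->
    linear_order r -> K (expand r) ->
    exists r' : rel B0, [/\ linear_order r', K (expand r')
      & @embedding L (expand r) (expand r') h].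

Definition ordering_property (K : class L) : Prop :=
  forall A0, class_reduct K A0 ->
  exists2 B0, class_reduct K B0 &
    forall (r : rel A0) (r' : rel B0),
      linear_order r -> linear_order r' ->
      K (expand r) -> K (expand r') -> embeds (expand r) (expand r').

End Orders.

Section Formulas.
Variables (L : signature) (V : Type).

Inductive term :=
  | Var of V
  | App (f : fsym L) of 'I_(far f) -> term.

(* Quantifier-free formulas of L_{omega1,omega} with variables in V. Nonempty
   finite conjunctions and disjunctions are obtained by repetition; empty ones
   amount to the trivial formulas t = t and ~ (t = t). *)
Inductive simple_formula :=
  | Eq of term & term
  | Rel (R : rsym L) of 'I_(rar R) -> term
  | Not of simple_formula
  | And of nat -> simple_formula
  | Or of nat -> simple_formula.

Variables (A : fstructure L) (v : V -> A).

Fixpoint eval (t : term) : A :=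
  match t with
  | Var x => v x
  | App f ts => fint A f [ffun i => eval (ts i)]
  end.

Fixpoint sat (phi : simple_formula) : Prop :=
  match phi with
  | Eq t u => eval t = eval u
  | Rel R ts => rint A R [ffun i => eval (ts i)]
  | Not psi => ~ sat psi
  | And psis => forall n, sat (psis n)
  | Or psis => exists n, sat (psis n)
  end.

End Formulas.

Inductive xy := VarX | VarY.

Section BiDefinability.
Variable L0 : signature.
Notation L := (add_lt L0).

Definition defined_rel (phi : simple_formula L xy) (A0 : fstructure L0)
    (r : rel A0) : rel A0 :=
  fun a b => `[< @sat L xy (expand r)
                   (fun z => match z with VarX => a | VarY => b end) phi >].

(* The expansions <A0, r> lying in K, given by the relation r. *)
Definition admissible (K : class L) (A0 : fstructure L0) : set (rel A0) :=
  [set r | K (expand r)]%classic.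

Definition simply_bidefinable (K0 : class L0) (K K' : class L) : Prop :=
  exists phi phi' : simple_formula L xy,
  forall A0, K0 A0 ->
    [/\ set_bij (@admissible K A0) (@admissible K' A0) (@defined_rel phi A0),
        forall r : rel A0, admissible K r -> defined_rel phi' (defined_rel phi r) = r
      & forall r : rel A0, admissible K' r -> defined_rel phi (defined_rel phi' r) = r].

End BiDefinability.

(* Main.v *)
Require Import Defs.
From HB Require Import structures.
From mathcomp Require Import all_boot.
From mathcomp Require Import boolp classical_sets functions.

Set Implicit Arguments.
Unset Strict Implicit.
Unset Printing Implicit Defensive.

(** Color the copies in a member of [K] of a structure generated by two points
    according to how some [K']-order compares these two points. The Ramsey
    property of [K] then gives, on every member of [K], a [K']-order that
    depends only on the quantifier-free types of pairs, and a compactness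
    argument makes the dependence uniform. So there is a map from [K]-orders to
    [K']-orders that commutes with embeddings, and by the ordering property of
    [K'] any such map is onto. Exchanging [K] and [K'], the two finite sets of
    expansions of a given structure have surjections in both directions, so the
    map is bijective; its inverse again commutes with embeddings. Finally, a
    binary relation preserved by embeddings is a union of quantifier-free
    types, of which there are only countably many, so that it is defined by a
    countable disjunction of countable conjunctions. *)

(** * Embeddings, substructures and copies *)

Lemma fmap_comp (n : nat) (T U W : Type) (h : T -> U) (g : U -> W)
    (t : {ffun 'I_n -> T}) : fmap g (fmap h t) = fmap (g \o h) t.
Proof. by apply/ffunP => i; rewrite !ffunE. Qed.

Lemma fmap_id (n : nat) (T : Type) (t : {ffun 'I_n -> T}) : fmap id t = t.
Proof. by apply/ffunP => i; rewrite ffunE. Qed.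

Lemma eq_fmap (n : nat) (T U : Type) (g h : T -> U) (t : {ffun 'I_n -> T}) :
  g =1 h -> fmap g t = fmap h t.
Proof. by move=> gh; apply/ffunP => i; rewrite !ffunE gh. Qed.

Section Embeddings.
Variable L : signature.
Implicit Types A B C : fstructure L.

Lemma embedding_id A : embedding (@id A).
Proof. by split=> [x y //|R t|f t]; rewrite fmap_id. Qed.

Lemma embedding_comp A B C (g : B -> C) (h : A -> B) :
  embedding g -> embedding h -> embedding (g \o h).
Proof.
move=> [gi gr gf] [hi hr hf]; split; first exact: inj_comp.
- by move=> R t; rewrite -fmap_comp gr hr.
- by move=> f t; rewrite -fmap_comp gf hf.
Qed.

Lemma embeds_refl A : embeds A A.
Proof. by exists id; exact: embedding_id. Qed.

Lemma embeds_trans B A C : embeds A B -> embeds B C -> embeds A C.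
Proof. by move=> [h eh] [g eg]; exists (g \o h); exact: embedding_comp. Qed.

Lemma embedding_inv A B (h : A -> B) (g : B -> A) :
  cancel h g -> cancel g h -> embedding h -> embedding g.
Proof.
move=> hK gK [hi hr hf]; split; first exact: can_inj gK.
- by move=> R t; rewrite -hr fmap_comp (eq_fmap _ gK) fmap_id.
- by move=> f t; apply: hi; rewrite -hf fmap_comp (eq_fmap _ gK) fmap_id gK.
Qed.

Lemma isomorphic_sym A B : isomorphic A B -> isomorphic B A.
Proof.
move=> [h eh [g hK gK]]; exists g; first exact: embedding_inv eh.
by exists h.
Qed.

Lemma embedding_val C (S : {set C}) (HS : is_substructure S) :
  embedding (val : substructure HS -> C).
Proof. by split=> //; exact: val_inj. Qed.

(** Together with its converse [copy_embedding], this trades the copies in the Ramsey property,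
    which are subsets, for embeddings. *)
Lemma embedding_copy A C (h : A -> C) :
  embedding h -> is_copy A (h @: [set: A]).
Proof.
move=> eh; have [hi hr hf] := eh.
have hS x : h x \in h @: [set: A] by rewrite imset_f.
have HS : is_substructure (h @: [set: A]).
  split; first by rewrite card_imset // cardsT carrier_gt0.
  move=> f t tS.
  have /choice[u hu] i : exists x, h x = t i.
    by have /imsetP[x _ ->] := tS i; exists x.
  have -> : t = fmap h [ffun i => u i] by apply/ffunP => i; rewrite !ffunE hu.
  by rewrite hf.
exists HS; apply: isomorphic_sym.
exists (fun x => exist _ (h x) (hS x) : substructure HS).
  split=> [x y [] /hi //|R t|f t].
    by rewrite -hr [LHS]/= fmap_comp.
  by apply: val_inj; rewrite /= fmap_comp -hf.
have /choice[g hg] (y : substructure HS) : exists x, h x = val y.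
  by have /imsetP[x _ ->] := valP y; exists x.
exists g => x; first by apply: hi; rewrite hg.
by apply: val_inj; rewrite /= hg.
Qed.

Lemma copy_embedding A C (S : {set C}) :
  is_copy A S -> exists2 h : A -> C, embedding h & h @: [set: A] = S.
Proof.
move=> [HS /isomorphic_sym[h eh [g hK gK]]].
exists (val \o h); first exact: embedding_comp (embedding_val HS) eh.
apply/setP => y; apply/imsetP/idP => [[x _ ->]|yS]; first exact: valP.
by exists (g (Sub y yS)); rewrite //= gK.
Qed.

End Embeddings.

(** * Quantifier-free types and generated substructures *)

Section QuantifierFreeTypes.
Variables (L : signature) (V : Type).
Implicit Types (A B C : fstructure L) (p : simple_formula L V).

Lemma eval_embedding A B (h : A -> B) (v : V -> A) t :
  embedding h -> eval (h \o v) t = h (eval v t).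
Proof.
move=> [_ _ hf]; elim: t => //= f ts IH; rewrite -hf; congr fint.
by apply/ffunP => i; rewrite !ffunE IH.
Qed.

Definition qf_equiv A B (v : V -> A) (w : V -> B) : Prop :=
  forall p, sat v p <-> sat w p.

Lemma qf_equiv_sym A B (v : V -> A) (w : V -> B) :
  qf_equiv v w -> qf_equiv w v.
Proof. by move=> vw p; rewrite vw. Qed.

Lemma qf_equiv_trans A B C (v : V -> A) (w : V -> B) (u : V -> C) :
  qf_equiv v w -> qf_equiv w u -> qf_equiv v u.
Proof. by move=> vw wu p; rewrite vw wu. Qed.

Lemma qf_equiv_embedding A B (h : A -> B) (v : V -> A) :
  embedding h -> qf_equiv v (h \o v).
Proof.
move=> eh; have [hi hr _] := eh.
elim=> [t u|R ts|p IH|ps IH|ps IH] /=.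
- by rewrite !eval_embedding //; split=> [->|/hi].
- suff -> : [ffun i => eval (h \o v) (ts i)] = fmap h [ffun i => eval v (ts i)].
    by rewrite hr.
  by apply/ffunP => i; rewrite !ffunE eval_embedding.
- by rewrite IH.
- by split=> H n; apply/IH.
- by split=> -[n H]; exists n; apply/IH.
Qed.

(** Negating the formula if necessary makes [v] the side that satisfies it. *)
Lemma separating_formula A B (v : V -> A) (w : V -> B) :
  ~ qf_equiv v w -> exists p, sat v p /\ ~ sat w p.
Proof.
move=> /existsNP[p vwp].
have [vp|nvp] := pselect (sat v p).
  by exists p; split=> // wp; apply: vwp.
by exists (Not p); split=> // nwp; apply: vwp; split.
Qed.

Section Generated.
Variables (A : fstructure L) (v : V -> A) (z0 : V).

Definition generated : {set A} := [set x | `[< exists t, eval v t = x >]].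

Lemma eval_generated t : eval v t \in generated.
Proof. by rewrite inE; apply/asboolP; exists t. Qed.

Lemma generated_term (x : A) : x \in generated -> exists t, eval v t = x.
Proof. by rewrite inE => /asboolP. Qed.

(** The variable [z0] supplies an element, as universes are nonempty. *)
Lemma generated_substructure : is_substructure generated.
Proof.
split.
  by apply/card_gt0P; exists (v z0); exact: (eval_generated (Var _ z0)).
move=> f t tG; have /choice[ts hts] i := generated_term (tG i).
have -> : t = [ffun i => eval v (ts i)] by apply/ffunP => i; rewrite ffunE hts.
exact: (eval_generated (App ts)).
Qed.

Definition gen_structure : fstructure L := substructure generated_substructure.

Definition generator (z : V) : gen_structure :=
  exist _ (v z) (eval_generated (Var L z)).

(** The value of a term under [v] is sent to its value under [w]. Equations between terms make this
    independent of the chosen term, injective and compatible with functions; relational atoms take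
    care of the relations. *)
Lemma gen_embedding B (w : V -> B) : qf_equiv v w ->
  exists2 h : gen_structure -> B, embedding h & h \o generator =1 w.
Proof.
move=> vw.
have /choice[tm tmE] (x : gen_structure) : exists t, eval v t = val x.
  exact/generated_term/valP.
have eqE t u : eval w t = eval w u <-> eval v t = eval v u.
  exact: iff_sym (vw (Eq t u)).
have fmapE n (t : {ffun 'I_n -> gen_structure}) :
    fmap val t = [ffun i => eval v (tm (t i))].
  by apply/ffunP => i; rewrite !ffunE tmE.
exists (fun x => eval w (tm x)); last first.
  by move=> z /=; apply/(eqE _ (Var L z)); rewrite tmE.
split=> [x y /eqE|R t|f t].
- by rewrite !tmE; exact: val_inj.
- have := vw (Rel (fun i => tm (t i))); rewrite /= -fmapE => vwR.
  by apply/idP/idP => /vwR.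
- by apply/(eqE (App (fun i => tm (t i)))); rewrite tmE /= fmapE.
Qed.

End Generated.

End QuantifierFreeTypes.

(** * Definability of relations preserved by embeddings *)

Definition point (T : Type) (a b : T) (z : xy) : T :=
  match z with VarX => a | VarY => b end.

Lemma comp_point (T U : Type) (h : T -> U) (a b : T) :
  h \o point a b = point (h a) (h b).
Proof. by apply/funext; case. Qed.

Section Definability.
Variables (L : signature) (K : class L) (e : nat -> fstructure L).
Hypothesis hereditaryK : hereditary K.
Hypothesis eP : forall A, K A -> exists n, isomorphic A (e n).

(** Both pairs are images of the two generators of one structure [G] embedded in [A] and in [B]. It
    lies in [K] by heredity, so the values of [N] can be compared in [G]. *)
Lemma qf_equiv_invariant (N : forall A : fstructure L, rel A) :
  (forall (A B : fstructure L) (h : A -> B) x y,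
     K A -> K B -> embedding h -> N B (h x) (h y) = N A x y) ->
  forall (A B : fstructure L) (a b : A) (c d : B), K A -> K B ->
    qf_equiv (point a b) (point c d) -> N A a b = N B c d.
Proof.
move=> NE A B a b c d KA KB /(gen_embedding VarX)[h eh hE].
set G := gen_structure _ _ in h eh hE.
have ev : embedding (val : G -> A) by exact: embedding_val.
have KG : K G by apply: hereditaryK KA; exists val.
have /= <- := hE VarX; have /= <- := hE VarY.
rewrite (NE _ _ _ _ _ KG KB eh).
by rewrite -(NE _ _ _ _ _ KG KA ev).
Qed.

(** Every member of [K] is isomorphic to some [e n], so these countably many pairs realize all
    quantifier-free types of pairs occurring in [K]. *)
Definition pointed : countType :=
  {n : nat & (carrier (e n) * carrier (e n))%type}.

Definition base (p : pointed) : xy -> e (tag p) :=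
  point (tagged p).1 (tagged p).2.

Lemma pointed_surj (A : fstructure L) (a b : A) :
  K A -> exists p : pointed,
    qf_equiv (point a b) (base p) /\ isomorphic A (e (tag p)).
Proof.
move=> /eP[n [h eh bh]].
exists (Tagged (fun n => (carrier (e n) * carrier (e n))%type) (h a, h b)
  : pointed).
split; last by exists h.
by rewrite /base /= -comp_point; exact: qf_equiv_embedding.
Qed.

Hypothesis isoK : iso_closed K.

(** The formula is the disjunction, over types [p] inside [N], of the conjunction, over types [q]
    outside [N], of a formula true at [p] and false at [q]. *)
Lemma definability (N : forall A : fstructure L, rel A) :
  (forall (A B : fstructure L) (h : A -> B) x y,
     K A -> K B -> embedding h -> N B (h x) (h y) = N A x y) ->
  exists phi : simple_formula L xy, forall (A : fstructure L) (a b : A),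
    K A -> sat (point a b) phi <-> N A a b.
Proof.
move=> NE.
pose good (p : pointed) :=
  K (e (tag p)) /\ N (e (tag p)) (tagged p).1 (tagged p).2.
pose bad (p : pointed) :=
  K (e (tag p)) /\ ~ N (e (tag p)) (tagged p).1 (tagged p).2.
pose top : simple_formula L xy := Eq (Var L VarX) (Var L VarX).
have /choice[sep sepE] (pq : pointed * pointed) : exists phi,
    good pq.1 -> bad pq.2 -> sat (base pq.1) phi /\ ~ sat (base pq.2) phi.
  have [[gp bq]|nH] := pselect (good pq.1 /\ bad pq.2); last first.
    by exists top => gp bq; case: nH.
  have [|phi] := @separating_formula _ _ _ _ (base pq.1) (base pq.2);
    last by exists phi.
  move=> /(qf_equiv_invariant NE) E.
  by case: gp bq => Kp Np [Kq]; rewrite -(E Kp Kq).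
(* Indices that are not relevant get neutral values: a false disjunct when [k] codes no good [p], a
   true conjunct when [l] codes no bad [q]. *)
pose psi k l := match unpickle k, unpickle l with
  | Some p, Some q => if `[< good p >] then if `[< bad q >] then sep (p, q)
                      else top else Not top
  | Some p, None => if `[< good p >] then top else Not top
  | None, _ => Not top end.
exists (Or (fun k => And (psi k))) => A a b KA /=.
have [p [abp Ap]] := pointed_surj a b KA.
have Kp : K (e (tag p)) by exact: isoK Ap KA.
have Np := qf_equiv_invariant NE KA Kp abp.
split=> [[k Hk]|Nab].
- apply: contrapT => nN.
  have bp : bad p by split=> //; rewrite -Np.
  have := Hk (pickle p); rewrite /psi pickleK.
  case: (unpickle k) => [q|]; last by case.
  case: asboolP => [gq|_]; last by case.
  have /asboolP -> := bp.
  have [_ /= npq] := sepE (q, p) gq bp.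
  by move=> /abp.
- have gp : good p by split=> //; rewrite -Np.
  exists (pickle p) => l; rewrite /psi pickleK.
  have /asboolP -> := gp.
  case: (unpickle l) => [q|//].
  case: asboolP => [bq|//].
  by have [/abp] := sepE (p, q) gp bq.
Qed.

(* The index of a chosen pointed structure [base p] realizing the type of
   [(a, b)]; it is [0] when there is none, which cannot happen in [K]. *)
Definition code (A : fstructure L) (a b : A) : nat :=
  xget 0 [set k | exists2 p : pointed, unpickle k = Some p
                                     & qf_equiv (point a b) (base p)]%classic.

Lemma codeE (A B : fstructure L) (a b : A) (c d : B) :
  qf_equiv (point a b) (point c d) -> code a b = code c d.
Proof.
move=> abcd; rewrite /code; congr xget; apply/seteqP; split=> k [p kp pE];
  exists p => //; apply: qf_equiv_trans pE => //; exact: qf_equiv_sym.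
Qed.

Lemma code_embedding (A B : fstructure L) (h : A -> B) a b :
  embedding h -> code (h a) (h b) = code a b.
Proof.
move=> eh; apply/codeE/qf_equiv_sym; rewrite -comp_point.
exact: qf_equiv_embedding.
Qed.

Lemma code_inj (A B : fstructure L) (a b : A) (c d : B) : K A -> K B ->
  code a b = code c d -> qf_equiv (point a b) (point c d).
Proof.
have codeP (C : fstructure L) (x y : C) : K C -> exists2 p : pointed,
    unpickle (code x y) = Some p & qf_equiv (point x y) (base p).
  move=> /(pointed_surj x y)[p [pE _]].
  rewrite /code; case: xgetP => [k _ [q kq qE]|H]; first by exists q.
  by case: (H (pickle p)); exists p; rewrite ?pickleK.
move=> /(codeP _ a b)[p pE abp] /(codeP _ c d)[q qE cdq].
move=> E; have [pq] : Some q = Some p by rewrite -pE -qE E.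
rewrite pq in cdq; exact: qf_equiv_trans abp (qf_equiv_sym cdq).
Qed.

End Definability.

(** * Compactness of Cantor space and rigidity of finite linear orders *)

(** The [P i] form a directed family of nonempty clopen sets. A common point is built bit by bit, as
    in König's lemma. *)
Lemma cantor_compactness (I : Type) (P : I -> (nat -> bool) -> Prop) :
  (forall i, exists f, P i f) ->
  (forall i j, exists k, forall f, P k f -> P i f /\ P j f) ->
  (forall i, exists n, forall f g,
     (forall m, m < n -> f m = g m) -> P i f -> P i g) ->
  exists f, forall i, P i f.
Proof.
move=> P0 Pdir Pfin.
(* The invariant: each [P i] has an element, possibly depending on [i], with prefix [w]. *)
pose ext w := forall i,
  exists2 f, P i f & forall m, m < size w -> f m = nth false w m.
(* If appending [true] fails at [i1], take an element with prefix [w] of some [P k] inside both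
   [P i1] and [P i]: its next bit has to be [false]. *)
have extS w : ext w -> ~ ext (rcons w true) -> ext (rcons w false).
  move=> extw /existsNP[i1 n1] i.
  have [k Pk] := Pdir i1 i; have [f Pf fw] := extw k.
  have [Pi1 Pi] := Pk f Pf.
  have fE b : f (size w) = b ->
      forall m, m < size (rcons w b) -> f m = nth false (rcons w b) m.
    move=> fb m; rewrite size_rcons ltnS leq_eqVlt nth_rcons => /predU1P[->|mw].
      by rewrite ltnn eqxx.
    by rewrite mw fw.
  case fb: (f (size w)); last by exists f => //; exact: fE.
  by case: n1; exists f => //; exact: fE.
pose fix w n :=
  if n is n'.+1 then rcons (w n') `[< ext (rcons (w n') true) >] else [::].
have size_w n : size (w n) = n by elim: n => //= n; rewrite size_rcons => ->.
have ext_w n : ext (w n).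
  elim: n => [|n IH] /=; first by move=> i; have [f Pf] := P0 i; exists f.
  by case: asboolP => [//|]; exact: extS.
have wE m n : m < n -> nth false (w n) m = nth false (w m.+1) m.
  elim: n => // n IH; rewrite ltnS leq_eqVlt => /predU1P[-> //|mn].
  by rewrite -IH //= nth_rcons size_w mn.
exists (fun n => nth false (w n.+1) n) => i.
have [n nE] := Pfin i; have [f Pf fw] := ext_w n i.
apply: nE Pf => m mn; rewrite fw ?size_w //; exact: wE.
Qed.

(** In the common image, [f x] and [g x] both have as many predecessors as [x] has for [r], and in a
    linear order this rank determines the element. *)
Lemma rigid_linear_order (T U : finType) (r : rel T) (s : rel U)
    (f g : T -> U) :
  linear_order s -> injective f -> injective g ->
  (forall x y, s (f x) (f y) = r x y) -> (forall x y, s (g x) (g y) = r x y) ->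
  f @: [set: T] = g @: [set: T] -> f =1 g.
Proof.
move=> [sirr str stot] fi gi fr gr fg x.
pose rk u := #|[set w in f @: [set: T] | s w u]|.
have below (h : T -> U) y :
    injective h -> (forall x y, s (h x) (h y) = r x y) ->
    h @: [set: T] = f @: [set: T] -> rk (h y) = #|[set z | r z y]|.
  move=> hi hr hf; rewrite -(card_imset _ hi) /rk -hf; apply: eq_card => w.
  apply/setIdP/imsetP => [[/imsetP[z _ ->]]|[z]].
    by rewrite hr => zy; exists z; rewrite // inE.
  by rewrite inE => zy ->; rewrite hr imset_f.
have rkE : rk (f x) = rk (g x) by rewrite (below f) ?(below g).
have rk_lt u w : u \in f @: [set: T] -> s u w -> rk u < rk w.
  move=> uf uw; apply: proper_card; apply/properP; split.
    apply/fintype.subsetP => v; rewrite !inE => /andP[-> vu] /=; exact: str uw.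
  by exists u; rewrite inE uf // sirr.
apply/eqP/negP => /negP/stot/orP[] /rk_lt; rewrite rkE ltnn => H.
- by apply/notF/H; exact: imset_f.
- by apply/notF/H; rewrite fg; exact: imset_f.
Qed.

(** * Expansions by a relation and reducts *)

Section OrderExpansions.
Variable L0 : signature.
Notation L := (add_lt L0).
Implicit Types (X Y : fstructure L0) (A B : fstructure L).

Lemma embedding_expand X Y (h : X -> Y) (r : rel X) (s : rel Y) :
  embedding h -> (forall x y, s (h x) (h y) = r x y) ->
  @embedding L (expand r) (expand s) h.
Proof.
move=> [hi hr hf] rs; split=> // -[R|] t /=; first exact: hr.
by rewrite !ffunE rs.
Qed.

Lemma embedding_lt A B (h : A -> B) x y :
  embedding h -> lt_of (h x) (h y) = lt_of x y.
Proof.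
move=> [_ hr _]; rewrite /lt_of -hr; congr rint.
by apply/ffunP => i; rewrite !ffunE; case: ifP.
Qed.

Lemma embedding_reduct A B (h : A -> B) :
  embedding h -> @embedding L0 (reduct A) (reduct B) h.
Proof. by move=> [hi hr hf]; split=> // R t; exact: (hr (Some R)). Qed.

Lemma lt_of_expand X (r : rel X) : @lt_of L0 (expand r) = r.
Proof. by apply/funext => x; apply/funext => y; rewrite /lt_of /= !ffunE. Qed.

Lemma reduct_expand X (r : rel X) : reduct (expand r) = X.
Proof. by case: X r. Qed.

(** The identity map works; what needs checking is that a tuple indexed by ['I_2] is recovered from
    its first and last entries. *)
Lemma expand_lt_of A : isomorphic (@expand L0 (reduct A) (@lt_of L0 A)) A.
Proof.
exists id; last by exists id.
split=> //; last by move=> f t; rewrite fmap_id.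
move=> [R|] t; rewrite fmap_id //= /lt_of; congr rint.
apply/ffunP => i; rewrite ffunE; case: eqP => [-> //|i0].
congr (t _); apply: val_inj; case: i i0 => -[|[|//]] lti //= [].
exact: val_inj.
Qed.

Lemma embedding_of_expand X Y (h : X -> Y) (r : rel X) (s : rel Y) :
  @embedding L (expand r) (expand s) h ->
  embedding h /\ forall x y, s (h x) (h y) = r x y.
Proof.
move=> eh; split.
  have [hi hr hf] := eh.
  by split=> // R t; exact: (hr (Some R)).
move=> x y; have := @embedding_lt (expand r) (expand s) h x y eh.
by rewrite !lt_of_expand.
Qed.

Lemma hereditary_pullback (K : class L) X Y (h : X -> Y) (s : rel Y) :
  hereditary K -> embedding h -> K (expand s) ->
  K (expand (fun x y => s (h x) (h y))).
Proof.
by move=> hpK eh; apply: hpK; exists h; exact: embedding_expand.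
Qed.

Lemma class_reduct_expand (K : class L) X : iso_closed K ->
  class_reduct K X <-> exists r : rel X, K (expand r).
Proof.
move=> isoK; split=> [[A KA <-]|[r Kr]].
  by exists (@lt_of L0 A); apply: isoK KA; apply/isomorphic_sym/expand_lt_of.
by exists (expand r) => //; exact: reduct_expand.
Qed.

Lemma linear_order_expand (K : class L) X (r : rel X) :
  fraisse_order_class K -> K (expand r) -> linear_order r.
Proof. by move=> [_ linK] /linK; rewrite lt_of_expand. Qed.

End OrderExpansions.

(** * From the Ramsey property to a uniform choice of orders *)

Section NaturalOrder.
Variable L0 : signature.
Notation L := (add_lt L0).
Variables K K' : class L.
Hypotheses (focK : fraisse_order_class K) (ramseyK : ramsey_property K).
Hypothesis hpK' : hereditary K'.
Hypothesis expandable :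
  forall A, K A -> exists r, K' (@expand L0 (reduct A) r).


(** Let [x] and [y] generate [G], and color the copies of [G] in [D] by the value of [s] at the two
    generators. A pair of [C] with the type of [(x, y)] generates a copy of [G], which [j] carries
    into the monochromatic copy of [C]. The relation [s] is arbitrary, so that the lemma can be
    iterated on pullbacks. *)
Lemma ramsey_pair (C : fstructure L) (x y : C) : K C ->
  exists D, [/\ K D, embeds C D & forall s : rel D,
    exists2 j : C -> D, embedding j & forall u v,
      qf_equiv (point x y) (point u v) -> s (j u) (j v) = s (j x) (j y)].
Proof.
move=> KC; have hpK := ramseyK.1.
pose G := gen_structure (point x y) VarX.
pose gx : G := generator (point x y) VarX VarX.
pose gy : G := generator (point x y) VarX VarY.
have GC : embeds G C by exists val; exact: embedding_val.
have KG : K G by exact: hpK KC.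
have [D [KD CD ramD]] := ramseyK.2 G C KG KC GC 2 isT.
exists D; split=> // s.
(* Embeddings of [G] in [D] with the same image coincide, so that the color of a
   copy is read off any of them. *)
pose c (S : {set D}) : 'I_2 := if `[< exists pi : G -> D,
    [/\ embedding pi, pi @: [set: G] = S & s (pi gx) (pi gy)] >]
  then ord_max else ord0.
have cE (pi : G -> D) : embedding pi ->
    (c (pi @: [set: G]) == ord_max) = s (pi gx) (pi gy).
  move=> epi; rewrite /c; case: asboolP => [[rho [erho rhoS srho]]|H].
    suff E : rho =1 pi by rewrite -!E srho eqxx.
    have [rhoi _ _] := erho; have [pii _ _] := epi.
    apply: (@rigid_linear_order _ _ (@lt_of L0 G) (@lt_of L0 D)) => //.
    - exact: focK.2.
    - by move=> *; exact: embedding_lt.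
    - by move=> *; exact: embedding_lt.
  by apply/esym/negP => spi; apply: H; exists pi.
have [S [/copy_embedding[j ej jS] [i ci]]] := ramD c.
have jE u v : qf_equiv (point x y) (point u v) ->
    s (j u) (j v) = (i == ord_max).
  move=> /(gen_embedding VarX)[h eh hE].
  have /= <- := hE VarX; have /= <- := hE VarY.
  have ejh := embedding_comp ej eh.
  rewrite -(cE _ ejh) (ci ((j \o h) @: [set: G])) //.
    exact: embedding_copy.
  apply/fintype.subsetP => _ /imsetP[z _ ->]; rewrite -jS; exact: imset_f.
exists j => // u v /jE ->; apply/esym/jE.
by move=> p.
Qed.

(** Pairs are treated one at a time: [D] handles the image of [(x, y)] in [C], and the induction
    hypothesis is applied to the pullback of [s] to [C]. *)
Lemma ramsey_pairs (B : fstructure L) (l : seq (B * B)) : K B ->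
  exists C, [/\ K C, embeds B C & forall s : rel C,
    exists2 g : B -> C, embedding g & forall p, p \in l -> forall u v,
      qf_equiv (point p.1 p.2) (point u v) ->
      s (g u) (g v) = s (g p.1) (g p.2)].
Proof.
move=> KB; elim: l => [|[x y] l [C [KC [b eb] IH]]].
  exists B; split=> //; first exact: embeds_refl.
  by move=> s; exists id; first exact: embedding_id.
have [D [KD CD HD]] := ramsey_pair (b x) (b y) KC.
exists D; split=> //; first by apply: embeds_trans CD; exists b.
move=> s; have [j ej jE] := HD s.
have [g eg gE] := IH (fun u v => s (j u) (j v)).
exists (j \o g); first exact: embedding_comp.
move=> p; rewrite inE => /predU1P[-> /= u v xyuv|pl u v]; last exact: gE.
(* Embeddings preserve types, so [g] sends pairs with the type of [(x, y)] to pairs with the type of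
   [(b x, b y)], on which [j] has made [s] constant. *)
have q u' v' : qf_equiv (point x y) (point u' v') ->
    qf_equiv (point (b x) (b y)) (point (g u') (g v')).
  move=> H; rewrite -!comp_point.
  apply: qf_equiv_trans (qf_equiv_embedding _ eg).
  apply: qf_equiv_trans H.
  exact/qf_equiv_sym/qf_equiv_embedding.
by rewrite (jE _ _ (q _ _ xyuv)) (jE (g x) (g y)) //; apply: q.
Qed.

(** A function [f] on codes of types gives a relation [ord f] that commutes with embeddings whatever
    [f] is. Compactness finds one [f] for which it yields an expansion in [K'] on all members of [K]
    at once. *)
Lemma natural_order : exists N : forall A : fstructure L, rel A,
  (forall (A B : fstructure L) (h : A -> B) x y,
     embedding h -> N B (h x) (h y) = N A x y) /\
  (forall A, K A -> K' (@expand L0 (reduct A) (N A))).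
Proof.
have [frK _] := focK; have hpK := ramseyK.1.
have [e eP] := fraisse_countable frK.
pose ord (f : nat -> bool) (A : fstructure L) : rel A :=
  fun a b => f (code e a b).
pose good (B : {B | K B}) f :=
  K' (@expand L0 (reduct (sval B)) (ord f (sval B))).
have ord_emb f (A B : fstructure L) (h : A -> B) x y :
    embedding h -> ord f B (h x) (h y) = ord f A x y.
  by move=> eh; rewrite /ord code_embedding.
have goodS A (B : {B | K B}) f :
    embeds (sval A) (sval B) -> good B f -> good A f.
  case: A B => A KA [B KB] /= [h eh]; rewrite /good /=.
  move/(hereditary_pullback hpK' (embedding_reduct eh)).
  congr (K' (expand _)).
  by apply/funext => x; apply/funext => y; exact: ord_emb.
suff [f fE] : exists f, forall B, good B f.
  exists (ord f); split=> [|A KA]; first exact: ord_emb.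
  exact: (fE (exist _ A KA)).
apply: cantor_compactness => [[B KB]|[A KA] [B KB]|[B KB]].
(* Nonemptiness: making all pairs of [B] homogeneous, the pullback of [s] along [g] depends only on
   codes, and [f] reads it off. *)
- have [C [KC _ HC]] := ramsey_pairs (enum {: B * B}) KB.
  have [s Ks] := expandable KC; have [g eg gE] := HC s.
  pose f k := `[< exists u v : B, code e u v = k /\ s (g u) (g v) >].
  exists f; rewrite /good /=.
  move: Ks => /(hereditary_pullback hpK' (embedding_reduct eg)).
  congr (K' (expand _)).
  apply/funext => x; apply/funext => y; apply/idP/asboolP => [sxy|].
    by exists x, y.
  move=> [u [v [uvxy suv]]].
  have := gE (x, y); rewrite mem_enum inE => /(_ isT u v) /= <- //.
  exact: (code_inj eP).
(* Directedness: joint embedding, goodness being inherited by substructures. *)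
- have [C [KC AC BC]] := fraisse_jep frK KA KB.
  by exists (exist _ C KC) => f fC; split; apply: goodS fC.
(* Finite dependence: only the codes of pairs from the finite structure [B] matter; the successor
   makes the bound strict. *)
- exists (\max_(p : B * B) code e p.1 p.2).+1 => f g fg; rewrite /good /=.
  congr (K' (expand _)); apply/funext => x; apply/funext => y.
  apply: fg; rewrite ltnS.
  exact: (@leq_bigmax _ (fun p : B * B => code e p.1 p.2) (x, y)).
Qed.

End NaturalOrder.

(** * Natural maps between expansions: surjectivity, injectivity, inverses *)

(** A surjection of a finite set onto itself is injective. Relations are encoded as finite functions
    so that they can be counted. *)
Lemma finite_surj_inj (T : finType) (D : rel T -> Prop) (F : rel T -> rel T) :
  (forall r, D r -> D (F r)) ->
  (forall s, D s -> exists2 r, D r & F r = s) ->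
  forall r r', D r -> D r' -> F r = F r' -> r = r'.
Proof.
move=> FD Fsurj.
pose enc (r : rel T) : {ffun T * T -> bool} := [ffun p => r p.1 p.2].
pose dec (g : {ffun T * T -> bool}) : rel T := fun x y => g (x, y).
have encK : cancel enc dec.
  by move=> r; apply/funext => x; apply/funext => y; rewrite /dec ffunE.
have decK : cancel dec enc by move=> g; apply/ffunP => -[x y]; rewrite ffunE.
pose P := [set g | `[< D (dec g) >]]%SET.
pose G g := enc (F (dec g)).
have inP g : (g \in P) = `[< D (dec g) >] by rewrite inE.
have GP : G @: P = P.
  apply/setP => g; apply/imsetP/idP => [[f]|].
    by rewrite !inP => /asboolP Df ->; apply/asboolP; rewrite encK; exact: FD.
  rewrite inP => /asboolP/Fsurj[r Dr Fr]; exists (enc r).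
    by rewrite inP encK; exact/asboolP.
  by rewrite /G encK Fr decK.
have /imset_injP Ginj : #|G @: P| == #|P| by rewrite GP.
move=> r r' Dr Dr' FF; apply: (can_inj encK); apply: Ginj.
- by rewrite inP encK; exact/asboolP.
- by rewrite inP encK; exact/asboolP.
- by rewrite /G !encK FF.
Qed.

Section NaturalBijection.
Variable L0 : signature.
Notation L := (add_lt L0).
Implicit Types X Y : fstructure L0.

Definition natural (N : forall A : fstructure L, rel A) : Prop :=
  forall (A B : fstructure L) (h : A -> B) x y,
    embedding h -> N B (h x) (h y) = N A x y.

Lemma natural_pullback (N : forall A : fstructure L, rel A) X Y
    (h : X -> Y) (r : rel Y) (x y : X) : natural N -> embedding h ->
  N (expand (fun x y => r (h x) (h y))) x y = N (expand r) (h x) (h y).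
Proof.
move=> natN eh; apply/esym.
apply: (natN (expand (fun x y => r (h x) (h y))) (expand r) h).
exact: embedding_expand.
Qed.

(** Let [Y] witness the ordering property for [X], and let [r] be any expansion of [Y] in [K]. Then
    [s] embeds in the image of [r] under [N], and by naturality the pullback of [r] to [X] is mapped
    to [s]. *)
Lemma natural_surj (K K' : class L) (N : forall A : fstructure L, rel A) X :
  hereditary K -> fraisse_order_class K' -> ordering_property K' ->
  class_reduct K' X ->
  (forall Y, class_reduct K' Y -> exists r : rel Y, K (expand r)) ->
  natural N ->
  (forall Y (r : rel Y), K (expand r) -> K' (@expand L0 Y (N (expand r)))) ->
  forall s : rel X, K' (expand s) ->
  exists2 r : rel X, K (expand r) & N (expand r) = s.
Proof.
move=> hpK focK' ordK' K'X expK natN NK s Ks.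
have [Y K'Y XY] := ordK' X K'X.
have [r Kr] := expK Y K'Y.
have Kt := NK Y r Kr.
have [h /embedding_of_expand[eh hs]] := XY s (N (expand r))
  (linear_order_expand focK' Ks) (linear_order_expand focK' Kt) Ks Kt.
exists (fun x y => r (h x) (h y)); first exact: hereditary_pullback Kr.
apply/funext => x; apply/funext => y; rewrite -hs.
exact: (@natural_pullback N X Y h r x y natN eh).
Qed.

Variables (K K' : class L) (N : forall A : fstructure L, rel A).
Arguments N : clear implicits.
Hypotheses (hpK : hereditary K) (isoK' : iso_closed K') (natN : natural N).
Hypothesis surjN : forall X (s : rel X), K' (expand s) ->
  exists2 r : rel X, K (expand r) & N (expand r) = s.
Hypothesis injN : forall X (r r' : rel X), K (expand r) -> K (expand r') ->
  N (expand r) = N (expand r') -> r = r'.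

(** The preimage of the order of [B] under [N], unique by [injN]; it is the empty relation when
    there is no preimage. *)
Definition inverse (B : fstructure L) : rel B := fun x y =>
  `[< exists r : rel B, [/\ K (@expand L0 (reduct B) r),
        N (@expand L0 (reduct B) r) = @lt_of L0 B & r x y] >].

Lemma inverseE (B : fstructure L) (r : rel B) :
  K (@expand L0 (reduct B) r) -> N (@expand L0 (reduct B) r) = @lt_of L0 B ->
  @inverse B = r.
Proof.
move=> Kr Nr; apply/funext => x; apply/funext => y.
apply/asboolP/idP => [[r' [Kr' Nr' r'xy]]|rxy]; last by exists r.
by rewrite (injN Kr Kr') // Nr Nr'.
Qed.

(** The pullback of the preimage for [B] is a preimage for [A], by naturality of [N], and preimages
    are unique. *)
Lemma inverse_natural (A B : fstructure L) (h : A -> B) x y :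
  K' B -> embedding h -> inverse (h x) (h y) = inverse x y.
Proof.
move=> KB eh.
have /surjN[r Kr Nr] : K' (@expand L0 (reduct B) (@lt_of L0 B)).
  by apply: isoK' KB; apply/isomorphic_sym/expand_lt_of.
rewrite (inverseE Kr Nr).
have eh0 := embedding_reduct eh.
rewrite (@inverseE A (fun x y => r (h x) (h y))) //.
  exact: (hereditary_pullback hpK eh0 Kr).
apply/funext => u; apply/funext => v.
rewrite -(@embedding_lt _ A B h u v eh) -Nr.
exact: (@natural_pullback N (reduct A) (reduct B) h r u v natN eh0).
Qed.

End NaturalBijection.

(** * Simple bi-definability of the two classes *)

Theorem theorem9p2 (L0 : signature) (K0 : class L0) (K K' : class (add_lt L0)) :
  fraisse_class K0 ->
  fraisse_order_class K -> fraisse_order_class K' ->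
  reasonable K -> reasonable K' ->
  expansion_of K K0 -> expansion_of K' K0 ->
  ramsey_property K -> ramsey_property K' ->
  ordering_property K -> ordering_property K' ->
  simply_bidefinable K0 K K'.
Proof.
move=> _ focK focK' _ _ expK expK' ramK ramK' ordK ordK'.
have [[isoK cntK _ hpK _ _] _] := focK.
have [[isoK' cntK' _ hpK' _ _] _] := focK'.
have K_K' X : class_reduct K X <-> class_reduct K' X by rewrite expK expK'.
have toK' A : K A -> exists r, K' (@expand L0 (reduct A) r).
  by move=> KA; apply/(class_reduct_expand _ isoK')/K_K'; exists A.
have toK A : K' A -> exists r, K (@expand L0 (reduct A) r).
  by move=> KA; apply/(class_reduct_expand _ isoK)/K_K'; exists A.
have [N [natN KN]] := natural_order focK ramK hpK' toK'.
have [N' [natN' KN']] := natural_order focK' ramK' hpK toK.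
have NK (X : fstructure L0) (r : rel X) :
    K (expand r) -> K' (@expand L0 X (N (expand r))) by exact: KN.
have NK' (X : fstructure L0) (r : rel X) :
    K' (expand r) -> K (@expand L0 X (N' (expand r))) by exact: KN'.
have surjN (X : fstructure L0) (s : rel X) : K' (expand s) ->
    exists2 r : rel X, K (expand r) & N (expand r) = s.
  move=> Ks; apply: (natural_surj hpK focK' ordK') (Ks) => //.
    by apply/(class_reduct_expand _ isoK'); exists s.
  by move=> Y /K_K'/(class_reduct_expand _ isoK).
have surjN' (X : fstructure L0) (s : rel X) : K (expand s) ->
    exists2 r : rel X, K' (expand r) & N' (expand r) = s.
  move=> Ks; apply: (natural_surj hpK' focK ordK) (Ks) => //.
    by apply/(class_reduct_expand _ isoK); exists s.
  by move=> Y /K_K'/(class_reduct_expand _ isoK').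
(* The composite of [N] and [N'] maps the finite set of expansions of [X] in [K] onto itself, so it
   is injective, and hence so is [N]. *)
have injN (X : fstructure L0) (r r' : rel X) : K (expand r) -> K (expand r') ->
    N (expand r) = N (expand r') -> r = r'.
  move=> Kr Kr' NN.
  apply: (@finite_surj_inj X (fun r => K (expand r))
    (fun r => N' (@expand L0 X (N (expand r))))) => //=; last by rewrite NN.
  - by move=> t Kt; apply/NK'/NK.
  - by move=> t /surjN'[s /surjN[u Ku <-] <-]; exists u.
have [e eP] := cntK; have [e' eP'] := cntK'.
have [phi phiE] := definability hpK eP isoK
  (fun A B h x y _ _ eh => natN A B h x y eh).
(* The formula [phi'] defines the inverse of [N]. The map [N'] served only to prove injectivity and
   need not be that inverse. *)
have [phi' phiE'] := definability hpK' eP' isoK'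
  (fun A B h x y _ KB eh =>
     inverse_natural hpK isoK' natN surjN injN x y KB eh).
have PhiE (X : fstructure L0) (r : rel X) :
    K (expand r) -> defined_rel phi r = N (expand r).
  move=> Kr; apply/funext => a; apply/funext => b; rewrite /defined_rel.
  by apply/asboolP/idP => /(phiE (expand r) a b Kr).
have PhiK (X : fstructure L0) (r : rel X) :
    K (expand r) -> defined_rel phi' (defined_rel phi r) = r.
  move=> Kr; rewrite PhiE //.
  set s : rel X := N (expand r); have Ks : K' (expand s) by exact: NK.
  have <- : @inverse L0 K N (expand s) = r.
    by apply: (inverseE injN); rewrite ?lt_of_expand.
  apply/funext => a; apply/funext => b; rewrite /defined_rel.
  by apply/asboolP/idP => /(phiE' (expand s) a b Ks).
exists phi, phi' => X _; split.
- split.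
  + by move=> r /= Kr; rewrite /admissible /= PhiE //; exact: NK.
  + move=> r r' /set_mem Kr /set_mem Kr' E.
    by rewrite -(PhiK _ _ Kr) -(PhiK _ _ Kr') E.
  + by move=> s /surjN[r Kr Nr]; exists r => //; rewrite PhiE.
- by move=> r /PhiK.
(* Each [s] is the image of some [r], so this identity reduces to the previous one. *)
- by move=> s /surjN[r Kr <-]; rewrite -PhiE // PhiK.
Qed.
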